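(* For every $n$-node weighted graph $G$, $k\ge1$ and positive integer $f$, the output $H$ of the Light Fault-Tolerant Greedy Spanner Algorithm on input $(G,k,f)$ satisfies $$\ell_{2f}(H\mid G)\le O\big(f\cdot\lambda(n,k+1)\big).$$
   Context: Graphs have nonnegative edge weights; $w(H)$ is total weight, $\mathrm{mst}(H)$ a minimum spanning tree (forest). A subgraph $Q\subseteq G$ is an $f'$-EFT connectivity preserver if for every edge set $F$ with $|F|\le f'$ the connected components of $Q\setminus F$ equal those of $G\setminus F$. The $f'$-competitive lightness is $\ell_{f'}(H\mid G):=w(H)/\min_Q w(Q)$ over all $f'$-EFT connectivity preservers $Q$ of $G$. Light Fault-Tolerant Greedy Spanner Algorithm on input $(G,k,f)$: let $Q$ be a minimum-weight $2f$-EFT connectivity preserver of $G$; $H\leftarrow Q$; for each edge $(u,v)\in E(G)\setminus Q$ in nondecreasing weight order, add $(u,v)$ to $H$ iff there exists $F\subseteq E(H)$, $|F|\le f$, with $\mathrm{dist}_{H\setminus F}(u,v)>k\cdot w(u,v)$ (current $H$); return $H$. Lightness $\ell(H)=w(H)/w(\mathrm{mst}(H))$; normalized weight of a cycle $C$ is $w(C)/\max_{e\in C}w(e)$; weighted girth is the minimum normalized weight over cycles; $\lambda(n,t):=\sup\ell(G)$ over $n$-node graphs $G$ of weighted girth $>t$. *)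

(* Defs.v *)
From HB Require Import structures.
From mathcomp Require Import all_boot all_order all_algebra.
From mathcomp Require Import boolp classical_sets reals ereal.

Set Implicit Arguments.
Unset Strict Implicit.
Unset Printing Implicit Defensive.

Import Order.TTheory GRing.Theory Num.Theory.
Local Open Scope ring_scope.

(* Finite simple undirected graphs: an edge is a two-element vertex set. A
   subgraph is given by its edge set; only the weights of edges are
   constrained, [weight] being arbitrary elsewhere. *)
Record wgraph (R : realType) (V : finType) := WGraph {
  edges : {set {set V}};
  weight : {set V} -> R;
  edges_card2 : forall e, e \in edges -> #|e| = 2%N;
  weight_ge0 : forall e, e \in edges -> 0 <= weight e }.

Section Subgraphs.
Context {V : finType}.
Implicit Types S T : {set {set V}}.

Definition adj S : rel V := fun u v => [set u; v] \in S.

Definition is_cycle S (c : seq V) : bool :=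
  (2 < size c)%N && ucycleb (adj S) c.

Definition cycle_edges (c : seq V) : {set {set V}} :=
  [set [set x; next c x] | x in c].

Definition same_components S T : Prop :=
  forall u v, connect (adj S) u v = connect (adj T) u v.

End Subgraphs.

Section WeightedGraphs.
Context {R : realType} {V : finType}.
Implicit Types (G : wgraph R V) (S T Q F H : {set {set V}}) (e : {set V}).

Definition total_weight G S : R := \sum_(e in S) weight G e.

Definition walk_weight G (u : V) (p : seq V) : R :=
  \sum_(e <- pairmap (fun x y => [set x; y]) u p) weight G e.

(* +oo if u and v are not connected in S *)
Definition dist G S (u v : V) : \bar R :=
  ereal_inf [set (walk_weight G u p)%:E |
    p in [set p | path (adj S) u p /\ last u p = v]]%classic.

Definition spanning_forest G T : Prop :=
  [/\ T \subset edges G, forall c, ~~ is_cycle T c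
    & same_components T (edges G)].

Definition mst_weight G : \bar R :=
  ereal_inf [set (total_weight G T)%:E | T in spanning_forest G]%classic.

(* All the ratios below are taken in \bar R, where x / 0 = +oo for x > 0 and
   0 / 0 = 0. *)
Definition lightness G : \bar R :=
  ((total_weight G (edges G))%:E / mst_weight G)%E.

Definition normalized_weight G (c : seq V) : \bar R :=
  ((total_weight G (cycle_edges c))%:E /
   (\big[Num.max/0]_(e in cycle_edges c) weight G e)%:E)%E.

(* +oo if G is a forest *)
Definition weighted_girth G : \bar R :=
  ereal_inf [set normalized_weight G c |
    c in [set c | is_cycle (edges G) c]]%classic.

Definition eft_preserver (f : nat) G Q : Prop :=
  Q \subset edges G /\
  forall F, (#|F| <= f)%N -> same_components (Q :\: F) (edges G :\: F).

Definition min_eft_preserver (f : nat) G Q : Prop :=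
  eft_preserver f G Q /\
  forall Q', eft_preserver f G Q' -> total_weight G Q <= total_weight G Q'.

Definition competitive_lightness (f : nat) H G : \bar R :=
  ((total_weight G H)%:E /
   ereal_inf [set (total_weight G Q)%:E | Q in eft_preserver f G]%classic)%E.

Definition greedy_test G (k : R) (f : nat) H e : bool :=
  [exists u, exists v, exists F : {set {set V}},
    [&& e == [set u; v], F \subset H, (#|F| <= f)%N &
        ((k * weight G e)%:E < dist G (H :\: F) u v)%E]].

Definition greedy_step G (k : R) (f : nat) H e : {set {set V}} :=
  if greedy_test G k f H e then e |: H else H.

(* The algorithm leaves free the choice of Q and the order of edges of equal
   weight: H is an output if it is reached by some such choices. *)
Definition light_ft_greedy_output G (k : R) (f : nat) H : Prop :=
  exists Q (s : seq {set V}),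
    [/\ min_eft_preserver (2 * f) G Q,
        perm_eq s (enum (edges G :\: Q)),
        sorted (fun e1 e2 => weight G e1 <= weight G e2) s
      & H = foldl (greedy_step G k f) Q s].

End WeightedGraphs.

Definition lambda {R : realType} (n : nat) (t : R) : \bar R :=
  ereal_sup [set lightness G |
    G in [set G : wgraph R 'I_n | (t%:E < weighted_girth G)%E]]%classic.

(* Main.v *)
Require Import Defs.
From mathcomp Require Import all_boot all_order all_algebra.
From mathcomp Require Import boolp classical_sets reals ereal.
From mathcomp Require Import fintype finset ring lra zify.

(** Write X for the greedy edges H \ Q and F_e for the fault set witnessing that
    e was added.  The endpoints of each e in X are (2f+1)-edge-connected in Q, so
    for every cost on Q some forest T in Q connects all these pairs at no more
    than 2/(2f+1) of the total cost (Goemans-Williamson bound).  Charging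
    w(g) w(X) / (4 w(Q)) + sum_(e in X, g in F_e) w(e) to an edge g, such a T
    avoids F_e for edges e of total weight at least w(X) w(T) / (4 w(Q)).  As
    F_e only contains edges older than e, these edges are (f+1)-colourable with
    no e and e' in F_e of equal colour; let D be the heaviest colour class.
    With M a minimum spanning forest of T and D, the graph M + D has weighted
    girth > k+1, whence w(D) <= lambda w(M) <= lambda w(T), and
    w(X) <= 4 (f+1) lambda w(Q). *)

Set Implicit Arguments.
Unset Strict Implicit.
Unset Printing Implicit Defensive.

Import Order.TTheory GRing.Theory Num.Theory.
Local Open Scope ring_scope.

(** * Connectivity and cuts *)

Section Connectivity.
Context {V : finType}.
Implicit Types (S T Z X : {set {set V}}) (W : {set V}) (a b u v x y : V).

(** With [h] the identity this reroutes single edges along detours; with a non-injective [h] it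
    pushes walks through a collapse of vertices. *)
Lemma connect_homo (W' : finType) (r : rel V) (r' : rel W') (h : V -> W') :
  (forall x y, r x y -> connect r' (h x) (h y)) ->
  forall x y, connect r x y -> connect r' (h x) (h y).
Proof.
move=> hr x y /connectP[p]; elim: p x => [|z p IH] x /=; first by move=> _ ->.
by case/andP=> /hr xz zp /(IH _ zp); apply: connect_trans.
Qed.

Lemma eq_set2 a b x y : [set a; b] = [set x; y] ->
  (a = x /\ b = y) \/ (a = y /\ b = x).
Proof.
move=> E; have : [/\ a \in [set x; y], b \in [set x; y], x \in [set a; b] & y \in [set a; b]].
  by split; [rewrite -E set21|rewrite -E set22|rewrite E set21|rewrite E set22].
case; rewrite !inE.
by do 4 case/orP=> /eqP ?; subst; auto.
Qed.

Lemma adj_sym S : symmetric (adj S).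
Proof. by move=> x y; rewrite /adj setUC. Qed.

Lemma connect_adjC S : connect_sym (adj S).
Proof. exact/sym_connect_sym/adj_sym. Qed.

Lemma connect_adjS S T : S \subset T ->
  subrel (connect (adj S)) (connect (adj T)).
Proof.
by move=> /subsetP ST; apply: connect_sub => x y xy; apply/connect1/ST.
Qed.

Lemma connect_exit (r : rel V) (P : pred V) x y :
  connect r x y -> P x -> ~~ P y -> exists a b, [/\ r a b, P a & ~~ P b].
Proof.
case/connectP=> p; elim: p x => [|z p IH] x /=; first by move=> _ -> ->.
case/andP=> xz zp ly Px Py; case Pz: (P z); first exact: IH zp ly Pz Py.
by exists x, z; rewrite Px Pz.
Qed.

(** A walk may use the new edge repeatedly, but the induction merges these uses into at most one.
    This serves the exchange argument for spanning forests. *)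
Lemma connect_adjU1 S x y a b : connect (adj ([set x; y] |: S)) a b ->
  connect (adj S) a b \/
  (connect (adj S) a x /\ connect (adj S) y b) \/
  (connect (adj S) a y /\ connect (adj S) x b).
Proof.
case/connectP=> p; elim: p a => [|z p IH] a /=; first by move=> _ ->; left.
case/andP=> + zp lb; have {IH zp lb} := IH _ zp lb.
rewrite /adj !inE => H /orP[/eqP E|az]; last first.
  have az' : connect (adj S) a z by exact: connect1.
  case: H => [H|[[H1 H2]|[H1 H2]]].
  - by left; apply: connect_trans H.
  - by right; left; split => //; apply: connect_trans H1.
  - by right; right; split => //; apply: connect_trans H1.
case: (eq_set2 E) => -[? ?]; subst a z; case: H => [H|[[H1 H2]|[H1 H2]]]; auto.
Qed.

Definition component S v : {set V} := [set u | connect (adj S) v u].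

Lemma in_component S u v : (u \in component S v) = connect (adj S) v u.
Proof. by rewrite inE. Qed.

Lemma component_refl S v : v \in component S v.
Proof. by rewrite in_component connect0. Qed.

Lemma eq_component S u v : (component S u == component S v) = connect (adj S) u v.
Proof.
apply/eqP/idP => [E|uv]; first by rewrite -in_component E component_refl.
by apply/setP=> z; rewrite !in_component (same_connect (connect_adjC S) uv).
Qed.

Definition components S : {set {set V}} := [set component S v | v in V].

Lemma componentsP S W : reflect (exists v, W = component S v) (W \in components S).
Proof. by apply: (iffP imsetP) => [[v _ ->]|[v ->]]; exists v. Qed.

Lemma component_in S v : component S v \in components S.
Proof. by apply/componentsP; exists v. Qed.

(** Sending each component of [S] to the component of [T] around it is still onto after dropping the
    component of [y], since that of [x] has the same image. *)
Lemma card_components_lt S T x y : S \subset T -> connect (adj T) x y ->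
  ~~ connect (adj S) x y -> (#|components T| < #|components S|)%N.
Proof.
move=> ST Txy Sxy.
pose h (W : {set V}) := \bigcup_(v in W) component T v.
have hE v : h (component S v) = component T v.
  apply/setP=> z; apply/bigcupP/idP => [[u]|vz]; last by exists v => //; apply: component_refl.
  by rewrite !in_component => /(connect_adjS ST) vu uz; apply: connect_trans uz.
have -> : components T = h @: (components S :\ component S y).
  apply/setP=> W; apply/componentsP/imsetP => [[v ->]|[W' /setD1P[_ /componentsP[v ->]] ->]]; last first.
    by exists v; rewrite hE.
  have [vy|vy] := eqVneq (component S v) (component S y); last first.
    by exists (component S v); rewrite ?hE // !inE vy component_in.
  exists (component S x); first by rewrite !inE eq_component Sxy component_in.
  rewrite hE; apply/eqP; rewrite eq_component connect_adjC; apply: connect_trans Txy _.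
  by apply: (connect_adjS ST); rewrite -eq_component eq_sym vy.
apply: leq_ltn_trans (leq_imset_card _ _) _.
by rewrite [ltnRHS](cardsD1 (component S y)) component_in.
Qed.

Definition crosses W (e : {set V}) := (e :&: W != set0) && (e :\: W != set0).

Lemma crosses2 W x y : crosses W [set x; y] = ((x \in W) != (y \in W)).
Proof.
rewrite /crosses; apply/andP/idP => [[/set0Pn[a] + /set0Pn[b]]|].
  rewrite !inE => /andP[/orP[]/eqP-> aW] /andP[bW /orP[]/eqP E];
    by move: bW; rewrite E aW // => /negPf ->.
case xW: (x \in W); case yW: (y \in W) => // _; split; apply/set0Pn.
- by exists x; rewrite !inE eqxx xW.
- by exists y; rewrite !inE eqxx orbT yW.
- by exists y; rewrite !inE eqxx orbT yW.
- by exists x; rewrite !inE eqxx xW.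
Qed.

Definition cut S W := [set e in S | crosses W e].

Lemma connect_cut S W x y : connect (adj S) x y -> x \in W -> y \notin W ->
  exists a b, [/\ [set a; b] \in cut S W, a \in W & b \notin W].
Proof.
move=> xy xW yW; have [a [b [ab aW bW]]] := connect_exit (P := fun z => z \in W) xy xW yW.
exists a, b; split=> //; rewrite inE crosses2 (negPf bW) aW.
by move: ab; rewrite /adj => ->.
Qed.

End Connectivity.

(** * Degrees in minimal Steiner forests over contracted components *)

Section Steiner.
Context {V : finType}.
Implicit Types (S T Z X A : {set {set V}}) (W : {set V}) (u v x y : V).

(** Feasibility in the Steiner forest problem with demand pairs [X]; boolean, so that [minset]
    applies to it. *)
Definition links S X :=
  [forall u, forall v, ([set u; v] \in X) ==> connect (adj S) u v].

Lemma linksP S X :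
  reflect (forall u v, [set u; v] \in X -> connect (adj S) u v) (links S X).
Proof.
apply: (iffP forallP) => [H u v uv|H u]; first by move/forallP/(_ v)/implyP: (H u); apply.
by apply/forallP=> v; apply/implyP/H.
Qed.

(** This says that [T] is a forest once the components of [Z] are contracted to points. *)
Definition independent_over Z T := forall x y,
  [set x; y] \in T -> ~~ connect (adj (Z :|: T :\ [set x; y])) x y.

(** By independence, each edge of [T] added to [Z] merges two components. *)
Lemma independent_card_components Z T : (forall e, e \in T -> #|e| = 2%N) ->
  independent_over Z T -> (#|components (Z :|: T)| + #|T| <= #|components Z|)%N.
Proof.
move: {2}#|T| (leqnn #|T|) => n; elim: n T => [|n IH] T.
  by rewrite leqn0 cards_eq0 => /eqP-> _ _; rewrite setU0 cards0 addn0.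
move=> Tn T2 indT; have [->|[g gT]] := set_0Vmem T.
  by rewrite setU0 cards0 addn0.
have /cards2P[x [y [_ gE]]] : #|g| == 2%N by apply/eqP/T2.
have TE := cardsD1 g T; rewrite gT in TE.
have IHg : (#|components (Z :|: T :\ g)| + #|T :\ g| <= #|components Z|)%N.
  apply: IH => [|e /setD1P[_ /T2] //|a b /setD1P[_ abT]]; first by lia.
  apply: contra (indT _ _ abT).
  by apply/connect_adjS/setUS/setSD/subD1set.
have : (#|components (Z :|: T)| < #|components (Z :|: T :\ g)|)%N.
  apply: (@card_components_lt _ _ _ x y); first by apply/setUS/subD1set.
    by apply: connect1; rewrite /adj -gE inE gT orbT.
  by rewrite gE; apply: indT; rewrite -gE.
by lia.
Qed.

(** An edge whose ends are joined by the other edges could be replaced by that detour, against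
    minimality. *)
Lemma minset_links_independent Z T X :
  minset (fun T => links (Z :|: T) X) T -> independent_over Z T.
Proof.
move=> /minsetP[/linksP lT minT] x y xyT; apply/negP => xy.
have /minT : links (Z :|: T :\ [set x; y]) X.
  apply/linksP => u v /lT; apply: (@connect_homo _ _ _ _ id) => a b.
  rewrite /adj !inE => /orP[abZ|abT]; first by apply: connect1; rewrite /adj inE abZ.
  have [E|ne] := eqVneq [set a; b] [set x; y]; last first.
    by apply: connect1; rewrite /adj !inE ne abT orbT.
  have ax : a \in [set x; y] by rewrite -E set21.
  have bx : b \in [set x; y] by rewrite -E set22.
  move: ax bx; rewrite !inE.
  by case/orP=> /eqP-> /orP[]/eqP->; rewrite ?connect0 // connect_adjC.
by move/(_ (subD1set _ _)) => E; move: xyT; rewrite -E setD11.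
Qed.

Lemma connect_in_component Z x y W : W \in components Z -> connect (adj Z) x y ->
  (x \in W) = (y \in W).
Proof.
case/componentsP=> v -> xy; rewrite !in_component.
by apply/idP/idP => H; apply: connect_trans H _; rewrite // connect_adjC.
Qed.

(* Collapsing a dead-end component onto the far end of its only edge keeps
   everything else connected. *)
Lemma minset_links_deg_neq1 Z T X W : (forall e, e \in T -> #|e| = 2%N) ->
  minset (fun T => links (Z :|: T) X) T -> W \in components Z ->
  (forall u v, [set u; v] \in X -> u \in W -> v \in W) -> #|cut T W| != 1%N.
Proof.
move=> T2 /minsetP[/linksP lT minT] WZ closedW; apply/negP=> /cards1P[g gE].
have : g \in cut T W by rewrite gE set11.
rewrite inE => /andP[gT].
have [a [b [ab gab]]] : exists a b, a != b /\ g = [set a; b].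
  have /cards2P[a [b [ab ?]]] : #|g| == 2%N by apply/eqP/T2.
  by exists a, b.
wlog aW : a b ab gab / a \in W => [wl|].
  case aW: (a \in W); first exact: (wl a b).
  case bW: (b \in W); first by apply: (wl b a); rewrite 1?eq_sym // setUC.
  by rewrite gab crosses2 aW bW.
rewrite gab crosses2 aW => bW; have {}bW : b \notin W by case: (b \in W) bW.
have /minT : links (Z :|: T :\ g) X.
  apply/linksP => u v uvX.
  (* A demand meeting [W] lies inside it and is linked by [Z] alone; any other has both ends outside
     [W], where [h] below is the identity. *)
  case uW: (u \in W).
    have vW := closedW _ _ uvX uW.
    apply: (@connect_adjS _ Z); first exact: subsetUl.
    case/componentsP: WZ uW vW => z ->; rewrite !in_component connect_adjC.
    exact: connect_trans.
  have vW : v \in W = false.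
    by apply/negP => vW; move: uW; rewrite (closedW v) // setUC.
  pose h z := if z \in W then b else z.
  have -> : u = h u by rewrite /h uW.
  have -> : v = h v by rewrite /h vW.
  apply: connect_homo (lT _ _ uvX) => x y xy; rewrite /h.
  case xW: (x \in W); case yW: (y \in W); rewrite ?connect0 //.
  (* An edge leaving [W] lies in the cut, hence is [g], and [h] sends both of its ends to [b]. *)
  - suff /eqP : [set x; y] = g.
      rewrite gab => /eqP E.
      have : y \in [set a; b] by rewrite -E set22.
      rewrite !inE => /orP[/eqP E'|/eqP->]; last exact: connect0.
      by rewrite E' aW in yW.
    apply/eqP; rewrite -in_set1 -gE inE crosses2 xW yW andbT.
    move: xy; rewrite /adj inE => /orP[/(@connect1 _ (adj Z))|//].
    by move/(connect_in_component WZ); rewrite xW yW.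
  - suff /eqP : [set x; y] = g.
      rewrite gab => /eqP E.
      have : x \in [set a; b] by rewrite -E set21.
      rewrite !inE => /orP[/eqP E'|/eqP->]; last exact: connect0.
      by rewrite E' aW in xW.
    apply/eqP; rewrite -in_set1 -gE inE crosses2 xW yW andbT.
    move: xy; rewrite /adj inE => /orP[/(@connect1 _ (adj Z))|//].
    by move/(connect_in_component WZ); rewrite xW yW.
  - apply: connect1; move: xy; rewrite /adj !inE => /orP[->//|->].
    rewrite andbT; case: eqP => [E|]; rewrite ?orbT //.
    have : a \in [set x; y] by rewrite E gab set21.
    by rewrite !inE => /orP[]/eqP E'; move: aW; rewrite E' ?xW ?yW.
by move/(_ (subD1set _ _)) => E; move: gT; rewrite -E setD11.
Qed.

Lemma crossed_components_le2 Z (e : {set V}) : #|e| = 2%N ->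
  (#|[set W in components Z | crosses W e]| <= 2)%N.
Proof.
move/eqP/cards2P=> [x [y [_ ->]]].
suff sub : [set W in components Z | crosses W [set x; y]] \subset [set component Z x; component Z y].
  by apply: leq_trans (subset_leq_card sub) _; rewrite cards2; case: eqP.
apply/subsetP=> W; rewrite inE => /andP[/componentsP[v ->]]; rewrite crosses2 !inE.
case xv: (connect _ v x); first by move: xv; rewrite -eq_component => ->.
by case yv: (connect _ v y) => // _; move: yv; rewrite -eq_component => ->; rewrite orbT.
Qed.

Lemma sum_cut S A :
  (\sum_(W in A) #|cut S W| = \sum_(e in S) #|[set W in A | crosses W e]|)%N.
Proof.
under eq_bigr do rewrite -sum1_card.
under [RHS]eq_bigr do rewrite -sum1_card.
rewrite (exchange_big_dep (mem S)) /=; last by move=> W e _; rewrite inE => /andP[].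
by apply: eq_bigr => e eS; apply: eq_bigl => W; rewrite !inE eS.
Qed.

(* The contracted forest [T / Z] has fewer edges than non-isolated nodes, and
   its nodes outside [A] are isolated or of degree at least 2. *)
Lemma sum_active_degrees Z T X A : (forall e, e \in T -> #|e| = 2%N) ->
  minset (fun T => links (Z :|: T) X) T -> A \subset components Z ->
  (forall W, W \in components Z -> W \notin A ->
     forall u v, [set u; v] \in X -> u \in W -> v \in W) ->
  (\sum_(W in A) #|cut T W| <= 2 * #|A|)%N.
Proof.
move=> T2 minT AZ inactive.
have forestT := independent_card_components T2 (minset_links_independent minT).
pose I := [set W in components Z | #|cut T W| == 0%N].
(* No edge of [T] leaves an isolated component, so it survives as a component of [Z :|: T]. *)
have I_le : (#|I| <= #|components (Z :|: T)|)%N.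
  apply/subset_leq_card/subsetP => W; rewrite inE => /andP[WZ]; rewrite cards_eq0 => /eqP T0.
  case/componentsP: (WZ) => v vW; apply/componentsP; exists v; rewrite vW.
  apply/setP=> u; rewrite !in_component; apply/idP/idP.
    exact/connect_adjS/subsetUl.
  move=> vu; apply/negPn/negP=> nvu.
  have vW' : v \in W by rewrite vW component_refl.
  have uW' : u \notin W by rewrite vW in_component.
  have [a [b [+ aW bW]]] := connect_cut vu vW' uW'.
  rewrite !inE => /andP[/orP[abZ|abT] cr]; last first.
    by have := in_set0 [set a; b]; rewrite -T0 inE abT cr.
  have := connect_in_component WZ (@connect1 _ (adj Z) a b abZ).
  by rewrite aW (negPf bW).
have degP : (\sum_(W in components Z) #|cut T W| <= 2 * #|T|)%N.
  rewrite sum_cut mulnC -sum_nat_const; apply: leq_sum => e eT.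
  exact/crossed_components_le2/T2.
have split_sum (F : {set V} -> nat) : (\sum_(W in components Z) F W =
    \sum_(W in A) F W + \sum_(W in components Z :\: A) F W)%N.
  rewrite (big_setID A) /=; congr addn.
  by apply: eq_bigl => W; rewrite (setIidPr AZ).
(* Outside [A] degree 1 is excluded; the added term makes up the missing 2 at isolated
   components. *)
have degN : (2 * #|components Z :\: A| <=
    \sum_(W in components Z :\: A) (#|cut T W| + 2 * (#|cut T W| == 0%N)))%N.
  rewrite mulnC -sum_nat_const; apply: leq_sum => W /setDP[WZ WA].
  have := minset_links_deg_neq1 T2 minT WZ (inactive _ WZ WA).
  by case: #|cut T W| => [|[|d]].
have IE : (\sum_(W in components Z) (#|cut T W| == 0%N) = #|I|)%N.
  by rewrite -big_mkcondr -sum1_card /=; apply: eq_bigl => W; rewrite inE.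
rewrite big_split /= -big_distrr /= in degN.
have /= sumT := split_sum (fun W => #|cut T W|).
have /= sumI := split_sum (fun W => nat_of_bool (#|cut T W| == 0%N)).
have := cardsID A (components Z); rewrite (setIidPr AZ) => cardZ.
rewrite IE in sumI.
(* Degrees sum to at most [2 * #|T|], and [T] has at most as many edges as there are non-isolated
   components. Taking off 2 for each non-isolated component outside [A] leaves at most
   [2 * #|A|]. *)
move: degN degP I_le forestT cardZ sumT sumI.
move: (\sum_(W in A) #|cut T W|)%N (\sum_(W in components Z) #|cut T W|)%N.
move: (\sum_(W in A) (#|cut T W| == 0%N))%N.
move: (\sum_(W in components Z :\: A) #|cut T W|)%N.
move: (\sum_(W in components Z :\: A) (#|cut T W| == 0%N))%N.
move: #|components Z| #|components (Z :|: T)| #|components Z :\: A| #|A| #|I| #|T|.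
by lia.
Qed.

End Steiner.

(** * A 2-approximate Steiner forest *)

Section SteinerApprox.
Context {R : realFieldType} {V : finType}.
Implicit Types (Q X Z T A : {set {set V}}) (W : {set V}) (c : {set V} -> R).

Lemma zero_edge_not_crossing Z W (e : {set V}) : #|e| = 2%N -> e \in Z ->
  W \in components Z -> ~~ crosses W e.
Proof.
move/eqP/cards2P=> [x [y [_ ->]]] xyZ WZ.
by rewrite crosses2 (connect_in_component WZ (@connect1 _ (adj Z) _ _ xyZ)) eqxx.
Qed.

(* The Goemans-Williamson bound for the fractional solution that is constantly
   1/m, in local-ratio form: charge every active component of the zero-cost
   edges uniformly until a new edge becomes free, and recurse. *)
Lemma steiner_forest_approx Q X m c : (0 < m)%N ->
  (forall e, e \in Q -> #|e| = 2%N) ->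
  (forall u v W, [set u; v] \in X -> u \in W -> v \notin W ->
     (m <= #|cut Q W|)%N) ->
  (forall e, e \in Q -> 0 <= c e) ->
  exists T, [/\ T \subset Q, links T X &
    m%:R * \sum_(e in T) c e <= 2 * \sum_(e in Q) c e].
Proof.
(* Induction on the number of edges of nonzero cost. *)
move=> m0 Q2 cutQ; have [n] := ubnP #|[set e in Q | c e != 0]|.
elim: n c => // n IH c cn c0.
pose Z := [set e in Q | c e == 0].
pose A := [set W in components Z |
  [exists u, exists v, [&& [set u; v] \in X, u \in W & v \notin W]]].
have ZQ : Z \subset Q by apply/subsetP=> e; rewrite inE => /andP[].
have cZ e : e \in Z -> c e = 0 by rewrite inE => /andP[_ /eqP].
have AZ : A \subset components Z by apply/subsetP=> W; rewrite inE => /andP[].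
have [A0|[W0 W0A]] := set_0Vmem A.
  exists Z; split=> //.
    apply/linksP=> u v uvX; apply/negPn/negP=> nuv.
    suff : component Z u \in A by rewrite A0 inE.
    rewrite inE component_in; apply/existsP; exists u; apply/existsP; exists v.
    by rewrite uvX component_refl in_component.
  by rewrite big1 ?mulr0 ?mulr_ge0 // sumr_ge0.
have cutA W : W \in A -> (m <= #|cut Q W|)%N.
  rewrite inE => /andP[_ /existsP[u /existsP[v /and3P[uv uW vW]]]].
  exact: cutQ uv uW vW.
pose r e := #|[set W in A | crosses W e]|.
have rZ e : e \in Z -> r e = 0%N.
  move=> eZ; apply/eqP; rewrite cards_eq0; apply/eqP/setP=> W; rewrite !inE -/Z.
  apply/negP=> /andP[/andP[WZ _]]; apply/negP.
  by apply: (zero_edge_not_crossing _ eZ) => //; apply/Q2/(subsetP ZQ).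
have [e0 e0P] : exists e, (e \in Q) && (0 < r e)%N.
  have := leq_trans m0 (cutA _ W0A); rewrite card_gt0 => /set0Pn[e].
  rewrite inE => /andP[eQ eW]; exists e; rewrite eQ card_gt0.
  by apply/set0Pn; exists W0; rewrite inE W0A.
(* [eps] is the largest uniform charge that keeps all reduced costs [c'] nonnegative; at this value
   [e1] becomes free. *)
have [e1 /andP[e1Q re1] e1min] := @arg_minP _ _ _ e0
  (fun e => (e \in Q) && (0 < r e)%N) (fun e => c e / (r e)%:R) e0P.
pose eps := c e1 / (r e1)%:R.
have re1R : 0 < (r e1)%:R :> R by rewrite ltr0n.
have eps0 : 0 <= eps by rewrite divr_ge0 ?c0 ?ltW.
pose c' e := c e - eps * (r e)%:R.
have c'0 e : e \in Q -> 0 <= c' e.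
  move=> eQ; rewrite /c' subr_ge0; case re: (r e) => [|d]; first by rewrite mulr0 c0.
  by rewrite -ler_pdivlMr ?ltr0n // -re; apply: e1min; rewrite eQ re.
have c'n : (#|[set e in Q | c' e != 0%R]| < n)%N.
  rewrite -ltnS; apply: leq_trans cn; rewrite ltnS; apply: proper_card; apply/properP; split.
    apply/subsetP=> e; rewrite !inE => /andP[eQ c'e]; rewrite eQ /=.
    apply: contra c'e => /eqP ce; have eZ : e \in Z by rewrite inE eQ ce eqxx.
    by rewrite /c' ce rZ // mulr0 subrr.
  exists e1.
    rewrite inE e1Q; apply/negP=> /eqP ce; have /rZ r1 : e1 \in Z by rewrite inE e1Q ce eqxx.
    by rewrite r1 in re1.
  by rewrite !inE e1Q /c' /eps divfK ?subrr ?eqxx // gt_eqF.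
have [T' [T'Q lT' cT']] := IH c' c'n c'0.
(* The recursive solution is pruned to be minimal over [Z], as the degree bound requires; adding [Z]
   back costs nothing. *)
have [T minT TT'] : {T | minset (fun T => links (Z :|: T) X) T & T \subset T'}.
  apply: minset_exists; apply/linksP=> u v /(linksP _ _ lT').
  exact/connect_adjS/subsetUr.
have TQ := fintype.subset_trans TT' T'Q.
have degT : (\sum_(W in A) #|cut T W| <= 2 * #|A|)%N.
  apply: sum_active_degrees minT AZ _ => [e /(subsetP TQ)/Q2 //|W WZ WA u v uvX uW].
  apply/negPn/negP=> vW; move/negP: WA; apply; rewrite inE WZ /=.
  by apply/existsP; exists u; apply/existsP; exists v; rewrite uvX uW.
have degQ : (m * #|A| <= \sum_(W in A) #|cut Q W|)%N.
  by rewrite mulnC -sum_nat_const; apply: leq_sum.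
have cE (S : {set {set V}}) : \sum_(e in S) c e =
    \sum_(e in S) c' e + eps * (\sum_(W in A) #|cut S W|)%:R.
  rewrite sum_cut natr_sum mulr_sumr -big_split /=.
  by apply: eq_bigr => e _; rewrite /c' subrK.
exists (Z :|: T); split; first by rewrite subUset ZQ.
  by case/minsetP: minT.
have -> : \sum_(e in Z :|: T) c e = \sum_(e in T) c e.
  rewrite (big_setID T) /= (setIidPr (subsetUr _ _)) setDUl setDv setU0.
  by rewrite [X in _ + X]big1 ?addr0 // => e /setDP[/cZ].
rewrite !cE.
have c'T : \sum_(e in T) c' e <= \sum_(e in T') c' e.
  rewrite [leRHS](big_setID T) /= (setIidPr TT') lerDl.
  by rewrite sumr_ge0 // => e /setDP[/(subsetP T'Q)/c'0].
(* The charged part obeys the ratio by itself: active degrees sum to at most [2 * #|A|] in [T] and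
   to at least [m * #|A|] in [Q]. *)
have mT : (m * \sum_(W in A) #|cut T W| <= 2 * \sum_(W in A) #|cut Q W|)%N.
  by rewrite (leq_trans (leq_mul (leqnn m) degT)) // mulnCA leq_mul2l.
rewrite !mulrDr lerD //.
  by apply: le_trans cT'; rewrite ler_pM2l // ltr0n.
by rewrite !(mulrCA _ eps) -!natrM ler_wpM2l // ler_nat.
Qed.

End SteinerApprox.

(** * Cycles and minimum spanning forests *)

Section Walks.
Context {R : realType} {V : finType}.
Implicit Types (G : wgraph R V) (S T M D : {set {set V}}) (e : {set V}).

Definition walk_edges (u : V) (p : seq V) : seq {set V} :=
  pairmap (fun x y => [set x; y]) u p.

Lemma path_adjE S u p :
  path (adj S) u p = all (fun e => e \in S) (walk_edges u p).
Proof. by elim: p u => //= v p IH u; rewrite IH. Qed.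

Lemma walk_edges_sub u p e x : e \in walk_edges u p -> x \in e -> x \in u :: p.
Proof.
elim: p u => //= v p IH u; rewrite inE => /orP[/eqP->|/IH H xe].
  by rewrite !inE => /orP[]->; rewrite ?orbT.
by rewrite inE H ?orbT.
Qed.

Lemma walk_edges_uniq u p : uniq (u :: p) -> uniq (walk_edges u p).
Proof.
elim: p u => //= v p IH u /andP[uvp vp]; rewrite IH // andbT.
by apply: contra uvp => /walk_edges_sub; apply; rewrite set21.
Qed.

Lemma walk_weight_rcons G u p v :
  walk_weight G u (rcons p v) = walk_weight G u p + weight G [set last u p; v].
Proof.
rewrite /walk_weight; elim: p u => [|x p IH] u /=.
  by rewrite big_nil big_seq1 add0r.
by rewrite !big_cons IH addrA.
Qed.

Lemma rev_walk G S u p : path (adj S) u p ->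
  exists p', [/\ path (adj S) (last u p) p', last (last u p) p' = u
    & walk_weight G (last u p) p' = walk_weight G u p].
Proof.
elim: p u => [|v p IH] u /=; first by exists [::].
case/andP=> uv /IH[p' [vp' lp' wp']]; exists (rcons p' u).
rewrite rcons_path last_rcons walk_weight_rcons vp' lp' wp' adj_sym; split=> //.
by rewrite {2}/walk_weight /= big_cons addrC setUC.
Qed.

Lemma cycle_edges_sub S c : is_cycle S c -> cycle_edges c \subset S.
Proof.
case/andP=> _ /andP[cS _]; apply/subsetP=> e /imsetP[x xc ->].
exact: next_cycle cS xc.
Qed.

(** Rotating the cycle to start just after [e] turns the remaining edges into a simple path between
    the ends of [e]. *)
Lemma cycle_minus_edge S c e : is_cycle S c -> e \in cycle_edges c ->
  exists x p, [/\ e = [set x; last x p], uniq (walk_edges x p)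
    & path (adj (cycle_edges c :\ e)) x p].
Proof.
case/andP=> c3 /andP[_ cu] /imsetP[z zc ->]; set y := next c z.
have /rot_to[i p cE] : y \in c by rewrite mem_next.
have ypu : uniq (y :: p) by rewrite -cE rot_uniq.
have psub a : a \in y :: p -> a \in c by rewrite -cE mem_rot.
have := cycle_next ypu; rewrite /= rcons_path => /andP[yp /eqP lp].
have nE : next (y :: p) =1 next c by rewrite -cE; apply: next_rot.
rewrite (eq_fpath nE) in yp.
have lz : last y p = z.
  by apply: (can_inj (prev_next cu)); rewrite -nE.
exists y, p; rewrite lz; split; rewrite 1?setUC ?walk_edges_uniq //.
(* With at least three vertices, the path from [y] to [z] cannot use the closing edge: its first
   edge misses [z] and the later ones miss [y]. *)
have : (2 < size (y :: p))%N by rewrite -cE size_rot.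
case: p {cE} ypu psub yp lp nE lz => [//|a [//|b p]] ypu psub yp lp nE lz _.
have zq : z \in b :: p by rewrite -lz; apply: (mem_last b p).
have yz : y != z.
  by apply: contraTneq zq => <-; case/andP: ypu => /norP[_].
rewrite path_adjE; apply/allP=> g gw; rewrite !inE.
apply/andP; split.
  apply/eqP=> gE; move: gw; rewrite gE.
  rewrite -[walk_edges y _]/([set y; a] :: walk_edges a (b :: p)) in_cons.
  move=> /orP[/eqP E|/walk_edges_sub H].
    have : z \in [set y; a] by rewrite -E !inE eqxx ?orbT.
    rewrite !inE eq_sym (negPf yz) /= => /eqP za.
    by move: ypu => /= /and3P[_ + _]; rewrite -za zq.
  have : y \in [:: a, b & p] by apply: H; rewrite !inE eqxx ?orbT.
  by case/andP: ypu => /negPf->.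
move: psub yp gw {ypu lp lz}; move: [:: a, b & p] => q psub yp.
elim: q (y) psub yp => //= v q IH u psub /andP[/eqP uv vq].
rewrite inE => /orP[/eqP->|]; last by apply: IH => // t tq; apply: psub; rewrite inE tq orbT.
by apply/imsetP; exists u; rewrite ?psub ?mem_head // uv.
Qed.

Lemma total_weight_ge0 G S : S \subset edges G -> 0 <= total_weight G S.
Proof. by move=> /subsetP SG; rewrite sumr_ge0 // => e /SG/weight_ge0. Qed.

Lemma total_weightS G S T : S \subset T -> T \subset edges G ->
  total_weight G S <= total_weight G T.
Proof.
move=> ST TG; rewrite /total_weight [leRHS](big_setID S) /= (setIidPr ST) lerDl.
by apply: total_weight_ge0; apply: fintype.subset_trans (subsetDl _ _) TG.
Qed.

Lemma total_weightD1 G S e : e \in S ->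
  total_weight G S = weight G e + total_weight G (S :\ e).
Proof. by move=> eS; rewrite /total_weight (big_setD1 e). Qed.

Lemma walk_weight_le G T u p : T \subset edges G -> path (adj T) u p ->
  uniq (walk_edges u p) -> walk_weight G u p <= total_weight G T.
Proof.
rewrite path_adjE => TG /allP pT pu.
rewrite [walk_weight _ _ _](_ : _ = total_weight G [set e in walk_edges u p]).
  by apply: total_weightS => //; apply/subsetP=> e; rewrite inE => /pT.
rewrite /total_weight /walk_weight -/(walk_edges u p) big_uniq //=.
by apply: eq_bigl => e; rewrite inE.
Qed.

Lemma links_same_components S M : M \subset S -> links M S -> same_components M S.
Proof.
move=> MS /linksP lM u v; apply/idP/idP; first exact: connect_adjS.
by apply: (@connect_homo _ _ _ _ id) => x y; apply: lM.
Qed.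

(** The given [T] is a candidate, which bounds the weight of the minimum. The last clause is the
    exchange property: some edge of the cycle outside [M] could replace [e], so it is at least as
    heavy. *)
Lemma minimum_spanning_forest G S T : S \subset edges G -> T \subset S ->
  links T S -> exists M, [/\ M \subset S, links M S,
    forall c, ~~ is_cycle M c, total_weight G M <= total_weight G T &
    forall c e, is_cycle S c -> e \in cycle_edges c -> e \in M ->
      exists2 e', e' \in cycle_edges c :\: M & weight G e <= weight G e'].
Proof.
move=> SG TS lT.
have [M1 /andP[M1S lM1] M1min] := @arg_minP _ _ _ T
  (fun M => (M \subset S) && links M S) (total_weight G) (introT andP (conj TS lT)).
(* Edges of weight 0 may close cycles in the lightest set [M1]; an inclusion-minimal linking subset
   has none and weighs no more. *)
have [M minM MM1] : {M | minset (fun M => links (set0 :|: M) S) M & M \subset M1}.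
  by apply: minset_exists; rewrite set0U.
have indM := minset_links_independent minM.
have lM : links M S by case/minsetP: minM; rewrite set0U.
have MS := fintype.subset_trans MM1 M1S.
have wM M' : M' \subset S -> links M' S -> total_weight G M <= total_weight G M'.
  move=> M'S lM'; apply: le_trans (M1min M' _); last by rewrite M'S.
  by apply: total_weightS => //; apply: fintype.subset_trans SG.
exists M; split=> //; [|exact: wM|].
  move=> c; apply/negP=> cM.
  have [x xc] : exists x, x \in c.
    by case/andP: cM; case: c => // x c _ _; exists x; rewrite mem_head.
  have ec : [set x; next c x] \in cycle_edges c by apply/imsetP; exists x.
  have [a [p [eE _ pc]]] := cycle_minus_edge cM ec.
  have eM : [set a; last a p] \in M by rewrite -eE; apply: (subsetP (cycle_edges_sub cM)).
  move/negP: (indM _ _ eM); apply; rewrite set0U.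
  have : connect (adj (cycle_edges c :\ [set x; next c x])) a (last a p).
    by apply/connectP; exists p.
  by rewrite eE; apply/connect_adjS/setSD/cycle_edges_sub.
move=> c e cS ec eM.
have [x [p [eE _ pc]]] := cycle_minus_edge cS ec.
have xyc : connect (adj (cycle_edges c :\ e)) x (last x p) by apply/connectP; exists p.
move: (last x p) eE xyc => y eE xyc {p pc}.
have nxy : ~~ connect (adj (M :\ e)) x y.
  by have := indM x y; rewrite -eE eM set0U => /(_ isT).
(* The rest of the cycle joins the ends of [e], which [M :\ e] separates, so it leaves the side of
   [x] along some edge from [a] to [b]. *)
have [a [b [abc xa xb]]] := connect_exit xyc (connect0 (adj (M :\ e)) x) nxy.
move: abc; rewrite /adj => /setD1P[abe abc].
have abM : [set a; b] \notin M.
  apply: contra xb => abM; apply: connect_trans xa _.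
  by apply: connect1; rewrite /adj !inE abe.
exists [set a; b]; first by rewrite inE abM.
have abS : [set a; b] \in S by apply: (subsetP (cycle_edges_sub cS)).
have xyM' : connect (adj ([set a; b] |: M :\ e)) x y.
  have sub : M :\ e \subset [set a; b] |: M :\ e by apply: subsetUr.
  have ab : connect (adj ([set a; b] |: M :\ e)) a b.
    by apply: connect1; rewrite /adj setU11.
  (* In [M] the vertices [a] and [b] are joined only through [e], in the direction from [x] to [y];
     so [y] stays joined to [b] after the swap. *)
  have : connect (adj ([set x; y] |: M :\ e)) a b.
    by rewrite -eE setD1K //; apply: (linksP _ _ lM).
  case/connect_adjU1=> [ab'|[[_ yb]|[ay _]]].
  - by case/negP: xb; apply: connect_trans ab'.
  - apply: connect_trans (connect_adjS sub xa) (connect_trans ab _).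
    by rewrite connect_adjC; apply: connect_adjS yb.
  - by case/negP: nxy; apply: connect_trans ay.
have M'S : [set a; b] |: M :\ e \subset S.
  by rewrite subUset sub1set abS; apply: fintype.subset_trans MS; apply: subD1set.
have := wM _ M'S.
rewrite (total_weightD1 _ eM) (total_weightD1 G (setU11 [set a; b] (M :\ e))).
rewrite setU1K ?inE ?(negPf abM) ?andbF // lerD2r; apply.
apply/linksP=> u v /(linksP _ _ lM).
apply: (@connect_homo _ _ _ _ id) => s t stM.
have [stE|ste] := eqVneq [set s; t] e; last first.
  by apply: connect1; rewrite /adj !inE ste; move: stM; rewrite /adj => ->; rewrite orbT.
have sx : s \in [set x; y] by rewrite -eE -stE set21.
have tx : t \in [set x; y] by rewrite -eE -stE set22.
move: sx tx; rewrite !inE.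
by case/orP=> /eqP-> /orP[]/eqP->; rewrite ?connect0 // connect_adjC.
Qed.

End Walks.

(** * Lower bounds on lambda *)

Section Lambda.
Context {R : realType} {V : finType}.
Implicit Types (G : wgraph R V) (S M : {set {set V}}) (t : R).

Lemma normalized_weight_gt G c e t : 0 <= t -> cycle_edges c \subset edges G ->
  e \in cycle_edges c ->
  (forall e', e' \in cycle_edges c -> weight G e' <= weight G e) ->
  t * weight G e < total_weight G (cycle_edges c) ->
  (t%:E < normalized_weight G c)%E.
Proof.
move=> t0 cG ec emax wc; rewrite /normalized_weight.
have we0 : 0 <= weight G e by apply: weight_ge0; apply: (subsetP cG).
have -> : \big[Num.max/0]_(e' in cycle_edges c) weight G e' = weight G e.
  apply/le_anti/andP; split; first by apply/bigmax_leP.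
  exact: (le_bigmax_cond 0 (weight G) ec).
(* Were the largest weight 0, the whole cycle would weigh 0, against the strict bound. *)
have we : 0 < weight G e.
  rewrite lt_neqAle we0 andbT eq_sym; apply: contraTneq wc => w0; rewrite w0 mulr0 -leNgt.
  by rewrite sumr_le0 // => e' /emax; rewrite w0.
by rewrite inver gt_eqF // -EFinM lte_fin ltr_pdivlMr.
Qed.

Lemma weighted_girth_gt G t :
  (forall c, is_cycle (edges G) c -> (t%:E < normalized_weight G c)%E) ->
  (t%:E < weighted_girth G)%E.
Proof.
move=> Gt.
(* Normalized weight depends only on the edge set, so a minimum over finitely many sets lies below
   the infimum and the strict inequality survives. *)
pose nw (E : {set {set V}}) := ((total_weight G E)%:E /
   (\big[Num.max/0%R]_(e in E) weight G e)%:E)%E.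
pose m := \big[Order.min/+oo%E]_(E : {set {set V}} | (t%:E < nw E)%E) nw E.
apply: (@lt_le_trans _ _ m); first by apply/bigmin_gtP; rewrite ltry.
apply: le_ereal_inf_tmp => _ [c /= cG <-].
exact: (bigmin_le_cond +oo%E nw (Gt c cG)).
Qed.

Lemma mst_weight_ge0 G : (0 <= mst_weight G)%E.
Proof.
by apply: le_ereal_inf_tmp => _ [T [TG _ _] <-]; rewrite lee_fin total_weight_ge0.
Qed.

Lemma lightness_ge0 G : (0 <= lightness G)%E.
Proof.
by rewrite mule_ge0 ?inve_ge0 ?mst_weight_ge0 // lee_fin total_weight_ge0.
Qed.

Lemma lightness_le_weight G M (L : R) : spanning_forest G M ->
  (lightness G <= L%:E)%E -> total_weight G (edges G) <= L * total_weight G M.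
Proof.
move=> forestM lL.
have mstM : (mst_weight G <= (total_weight G M)%:E)%E.
  by apply: ereal_inf_lbound; exists M.
have wG := total_weight_ge0 (subxx (edges G)).
have L0 : 0 <= L.
  by rewrite -lee_fin; apply: le_trans lL; apply: lightness_ge0.
move: lL mstM (mst_weight_ge0 G); rewrite /lightness.
case: (mst_weight G) => [r| |] //; rewrite !lee_fin => lL rM r0.
apply: le_trans (ler_wpM2l L0 rM); move: lL; rewrite inver.
(* With a minimum forest of weight 0, the finite bound on lightness forces the total weight to be
   0. *)
case: eqVneq => [->|rn0].
  move: wG; rewrite le_eqVlt => /predU1P[<-|wG]; first by rewrite mulr0.
  by rewrite gt0_muley ?lte_fin // leye_eq.
by rewrite -EFinM lee_fin ler_pdivrMr // lt_neqAle eq_sym rn0.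
Qed.

End Lambda.

(** The edgeless graph has girth [+oo], so the supremum ranges over a nonempty set. *)
Lemma lambda_ge0 (R : realType) n (t : R) : (0 <= lambda n t)%E.
Proof.
have card2 (e : {set 'I_n}) : e \in set0 -> #|e| = 2%N by rewrite inE.
have ge0 (e : {set 'I_n}) : e \in set0 -> 0 <= 0 :> R by rewrite inE.
pose G0 := WGraph card2 ge0.
apply: le_trans (lightness_ge0 G0) _; apply: ereal_sup_ubound; exists G0 => //=.
apply: weighted_girth_gt => -[//|x c] /cycle_edges_sub/subsetP cG0.
have /cG0 : [set x; next (x :: c) x] \in cycle_edges (x :: c).
  by apply/imsetP; exists x; rewrite ?mem_head.
by rewrite in_set0.
Qed.

(** * Transfer of subgraphs to the vertex type of [lambda] *)

Section Relabel.
Context {R : realType} {V : finType}.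
Implicit Types (G : wgraph R V) (S M : {set {set V}}) (t : R).
Let h : 'I_#|V| -> V := enum_val.

Let hK : cancel h enum_rank. Proof. exact: enum_valK. Qed.
Let Kh : cancel enum_rank h. Proof. exact: enum_rankK. Qed.
Let h_inj : injective h. Proof. exact: can_inj hK. Qed.

Let hset (e : {set 'I_#|V|}) : {set V} := h @: e.

Let hset_bij : bijective hset.
Proof.
exists (fun e : {set V} => enum_rank @: e) => e; rewrite /hset -imset_comp.
  by rewrite (eq_imset _ hK) imset_id.
by rewrite (eq_imset _ Kh) imset_id.
Qed.

Let hset2 i j : hset [set i; j] = [set h i; h j].
Proof. by rewrite /hset imsetU !imset_set1. Qed.

Definition relabel S : {set {set 'I_#|V|}} := [set e | hset e \in S].

Lemma relabel_card2 G S : S \subset edges G ->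
  forall e, e \in relabel S -> #|e| = 2%N.
Proof.
move=> SG e; rewrite inE => /(subsetP SG)/edges_card2.
by rewrite card_imset.
Qed.

Lemma relabel_weight_ge0 G S : S \subset edges G ->
  forall e, e \in relabel S -> 0 <= weight G (hset e).
Proof. by move=> SG e; rewrite inE => /(subsetP SG)/weight_ge0. Qed.

(** The weight function is inferred from the type of [relabel_weight_ge0]: each edge weighs as much
    as its image under [hset]. *)
Definition relabel_graph G S (SG : S \subset edges G) : wgraph R 'I_#|V| :=
  WGraph (relabel_card2 SG) (relabel_weight_ge0 SG).

Lemma relabel_adj S i j : adj (relabel S) i j = adj S (h i) (h j).
Proof. by rewrite /adj inE hset2. Qed.

Lemma relabel_connect S i j :
  connect (adj (relabel S)) i j = connect (adj S) (h i) (h j).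
Proof.
apply/idP/idP.
  by apply: connect_homo => x y; rewrite relabel_adj => /connect1.
rewrite -{2}(hK i) -{2}(hK j).
by apply: connect_homo => x y xy; apply: connect1; rewrite relabel_adj !Kh.
Qed.

Lemma relabel_cycle S c : is_cycle (relabel S) c -> is_cycle S (map h c).
Proof.
case/andP=> c3 /andP[cS cu]; rewrite /is_cycle size_map c3 /ucycleb map_inj_uniq // cu andbT.
by rewrite cycle_map (eq_cycle (e' := adj (relabel S))) // => i j; rewrite relabel_adj.
Qed.

Lemma relabel_cycle_edges c : uniq c ->
  cycle_edges (map h c) = hset @: cycle_edges c.
Proof.
move=> cu; apply/setP=> e; apply/imsetP/imsetP.
  case=> _ /mapP[i ic ->] ->; exists [set i; next c i]; first by apply/imsetP; exists i.
  by rewrite hset2 next_map.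
case=> _ /imsetP[i ic ->] ->; exists (h i); first by rewrite map_f.
by rewrite hset2 next_map.
Qed.

Lemma relabel_total_weight G S (SG : S \subset edges G) M :
  total_weight (relabel_graph SG) (relabel M) = total_weight G M.
Proof.
rewrite /total_weight [RHS](reindex hset) /=; first by apply: eq_bigl => e; rewrite inE.
exact: onW_bij.
Qed.

(** The girth condition is phrased on [V] with an explicit heaviest edge on each cycle, which avoids
    quotients; after relabelling, the subgraph [S] is admissible in the supremum. *)
Lemma weight_le_lambda G S M t (L : R) : 0 <= t ->
  S \subset edges G -> M \subset S -> links M S -> (forall c, ~~ is_cycle M c) ->
  (forall c, is_cycle S c -> exists e, [/\ e \in cycle_edges c,
     forall e', e' \in cycle_edges c -> weight G e' <= weight G e &
     t * weight G e < total_weight G (cycle_edges c)]) ->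
  (lambda #|V| t <= L%:E)%E ->
  total_weight G S <= L * total_weight G M.
Proof.
move=> t0 SG MS lM Mac Sgirth lamL; pose G' := relabel_graph SG.
rewrite -!(relabel_total_weight SG) -/G'.
apply: (@lightness_le_weight _ _ G').
  split; first by apply/subsetP=> e; rewrite !inE => /(subsetP MS).
    by move=> c; apply/negP=> /relabel_cycle; apply/negP.
  by move=> i j; rewrite !relabel_connect; apply: links_same_components.
apply: le_trans lamL; apply: ereal_sup_ubound; exists G' => //=.
apply: weighted_girth_gt => c cS.
have cu : uniq c by case/andP: cS => _ /andP[].
have [e [+ emax wc]] := Sgirth _ (relabel_cycle cS).
rewrite relabel_cycle_edges // => /imsetP[i ic eE].
apply: (@normalized_weight_gt _ _ G' c i) => //.
- exact: cycle_edges_sub.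
- move=> j jc /=; rewrite -eE; apply: emax.
  by rewrite relabel_cycle_edges // imset_f.
- rewrite /= -eE; apply: lt_le_trans wc _.
  rewrite relabel_cycle_edges // /total_weight big_imset //=.
  by move=> ? ? _ _; apply: bij_inj.
Qed.

End Relabel.

(** * Independent subsets and the greedy algorithm *)

Section IndependentSubset.
Context {R : realFieldType} {T : finType}.
Implicit Types (D : {set T}) (F : T -> {set T}) (rank : T -> nat).

(** Greedy colouring by increasing rank: the at most [f] elements of [F e] leave one of the [f.+1]
    colours free for [e]. *)
Lemma degenerate_coloring D F rank f : {in D &, injective rank} ->
  {in D, forall e, (#|F e| <= f)%N} ->
  {in D &, forall e e', e' \in F e -> (rank e' < rank e)%N} ->
  exists col : T -> 'I_f.+1, {in D &, forall e e', e' \in F e -> col e != col e'}.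
Proof.
move=> inj_rank F_le F_rank.
suff col_lt n : exists col : T -> 'I_f.+1, {in D &, forall e e',
    (rank e < n)%N -> e' \in F e -> col e != col e'}.
  have [col colP] := col_lt (\max_e rank e).+1.
  by exists col => e e' eD e'D; apply: colP => //; rewrite ltnS leq_bigmax.
elim: n => [|n [col colP]]; first by exists (fun=> ord0).
case: (pickP (fun e => (e \in D) && (rank e == n))) => [a /andP[aD /eqP an]|none].
  have [j jF] : exists j, j \notin col @: F a.
    apply/existsP; rewrite -negb_forall; apply/negP => /forallP full.
    have : #|'I_f.+1| = #|col @: F a|.
      by apply: eq_card => j; rewrite full.
    rewrite card_ord => Ef; have := leq_trans (leq_imset_card col (F a)) (F_le _ aD).
    by rewrite -Ef ltnn.
  (* Recolouring [a] spoils no earlier constraint: injectivity makes [a] the only element of [D] of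
     rank [n], and [a] lies in no [F e] with [e] in [D] of rank at most [n]. *)
  exists (fun e => if e == a then j else col e) => e e' eD e'D; rewrite ltnS => en e'F.
  have e'e := F_rank _ _ eD e'D e'F.
  have [e'a|_] := eqVneq e' a; first by move: e'e; rewrite e'a an ltnNge en.
  have [ea|ea] := eqVneq e a.
    by apply: contraNneq jF => ->; rewrite imset_f // -ea.
  apply: colP => //; rewrite ltn_neqAle en andbT; apply: contraNneq ea => ren.
  by apply/eqP; apply: inj_rank; rewrite // ren an.
exists col => e e' eD e'D; rewrite ltnS leq_eqVlt => /predU1P[en|en]; last exact: colP.
by have := none e; rewrite eD en eqxx.
Qed.

Lemma heavy_independent_subset D F rank f (w : T -> R) : {in D &, injective rank} ->
  {in D, forall e, (#|F e| <= f)%N} ->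
  {in D &, forall e e', e' \in F e -> (rank e' < rank e)%N} ->
  exists D', [/\ D' \subset D, {in D' &, forall e e', e' \notin F e} &
    \sum_(e in D) w e <= f.+1%:R * \sum_(e in D') w e].
Proof.
move=> inj_rank F_le F_rank.
have [col colP] := degenerate_coloring inj_rank F_le F_rank.
pose wcol j := \sum_(e in D | col e == j) w e.
have [j _ jmax] := @arg_maxP _ _ _ (ord0 : 'I_f.+1) xpredT wcol isT.
exists [set e in D | col e == j]; split.
- by apply/subsetP=> e; rewrite inE => /andP[].
- move=> e e'; rewrite !inE => /andP[eD /eqP ej] /andP[e'D /eqP e'j].
  by apply/negP => /(colP _ _ eD e'D); rewrite ej e'j eqxx.
- have -> : \sum_(e in [set e in D | col e == j]) w e = wcol j.
    by apply: eq_bigl => e; rewrite inE.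
  rewrite (partition_big col xpredT) //= mulr_natl.
  apply: le_trans (ler_sum _ (fun i _ => jmax i isT)) _.
  by rewrite sumr_const card_ord.
Qed.

End IndependentSubset.

(** * What a run of the greedy algorithm guarantees *)

Section Greedy.
Context {R : realType} {V : finType}.
Variables (G : wgraph R V) (k : R) (f : nat).
Implicit Types (Q H X : {set {set V}}) (e : {set V}) (s : seq {set V}).

Let run Q s := foldl (greedy_step G k f) Q s.

Lemma greedy_run_sup Q s : Q \subset run Q s.
Proof.
elim: s Q => [|e s IH] Q //=; apply: fintype.subset_trans (IH _).
by rewrite /greedy_step; case: ifP => // _; apply: subsetUr.
Qed.

Lemma greedy_run_sub Q s : run Q s \subset Q :|: [set e in s].
Proof.
elim: s Q => [|e s IH] Q /=; first exact: subsetUl.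
apply: fintype.subset_trans (IH _) _; apply/subsetP=> g; rewrite !inE.
rewrite /greedy_step; case: ifP => _; rewrite ?inE.
  by case/orP=> [/orP[]|] ->; rewrite ?orbT.
by case/orP=> ->; rewrite ?orbT.
Qed.

(** As [s] has no repetitions, [e] can only enter at its own turn, when the current graph is the run
    on the preceding edges. *)
Lemma greedy_run_test Q s e : uniq s -> e \in run Q s -> e \notin Q ->
  greedy_test G k f (run Q (take (index e s) s)) e.
Proof.
move=> us eH eQ.
have es : e \in s.
  by move/subsetP/(_ _ eH): (greedy_run_sub Q s); rewrite !inE (negPf eQ).
have sE : s = take (index e s) s ++ e :: drop (index e s).+1 s.
  by rewrite -drop_index // cat_take_drop.
move: (take _ s) (drop _ s) sE => s1 s2 sE; rewrite {}sE in us eH *.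
move: us; rewrite cat_uniq /= => /and3P[_ /norP[es1 _] /andP[es2 _]].
have [//|ntest] := boolP (greedy_test _ _ _ _ _); exfalso.
move: eH; rewrite /run foldl_cat /= /greedy_step (negPf ntest).
move/(subsetP (greedy_run_sub _ _)); rewrite !inE (negPf es2) orbF.
by move/(subsetP (greedy_run_sub _ _)); rewrite !inE (negPf es1) orbF (negPf eQ).
Qed.

(** All that the weight bound needs to know of the algorithm. The rank is the position in the
    processing order, and walks are confined to [Q] and older greedy edges. *)
Lemma light_ft_greedy_outputP H : light_ft_greedy_output G k f H ->
  exists Q (rank : {set V} -> nat) (F : {set V} -> {set {set V}}),
  [/\ min_eft_preserver (2 * f) G Q, Q \subset H, H \subset edges G &
  forall e, e \in H :\: Q -> [/\ (#|F e| <= f)%N,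
    {in H :\: Q, forall e', e' \in F e -> (rank e' < rank e)%N},
    {in H :\: Q, forall e', rank e' = rank e -> e' = e},
    {in H :\: Q, forall e', (rank e' <= rank e)%N -> weight G e' <= weight G e} &
    exists u v, e = [set u; v] /\ forall p,
      path (adj ((Q :|: [set e' in H :\: Q | (rank e' < rank e)%N]) :\: F e)) u p ->
      last u p = v -> k * weight G e < walk_weight G u p]].
Proof.
case=> Q [s [minQ sE sorted_s ->]]; rewrite -/(run Q s).
have us : uniq s by rewrite (perm_uniq sE) enum_uniq.
have sP e : (e \in s) = (e \in edges G :\: Q) by rewrite (perm_mem sE) mem_enum.
have Xs e : e \in run Q s :\: Q -> e \in s.
  case/setDP=> /(subsetP (greedy_run_sub _ _)); rewrite !inE.
  by case/orP=> // ->.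
pose He e := run Q (take (index e s) s).
have /choice[F FP] : forall e, exists Fe : {set {set V}},
    greedy_test G k f (He e) e -> exists u v, [/\ e = [set u; v],
      Fe \subset He e, (#|Fe| <= f)%N &
      ((k * weight G e)%:E < dist G (He e :\: Fe) u v)%E].
  move=> e.
  have [|_] := boolP (greedy_test G k f (He e) e); last by exists set0.
  case/existsP=> u /existsP[v /existsP[Fe /and4P[/eqP eE FH Ff d]]].
  by exists Fe => _; exists u, v.
exists Q, (index^~ s), F; split=> //; first exact: greedy_run_sup.
  apply: fintype.subset_trans (greedy_run_sub _ _) _; rewrite subUset; case: minQ => -[-> _ _] /=.
  by apply/subsetP=> e; rewrite inE sP => /setDP[].
move=> e eX; have es := Xs _ eX.
have [eH eQ] := setDP eX.
have [u [v [eE FH Ff d]]] := FP _ (greedy_run_test us eH eQ).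
split=> //.
- move=> e' e'X /(subsetP FH)/(subsetP (greedy_run_sub _ _)); rewrite !inE.
  have [_ /negPf->] := setDP e'X.
  by rewrite /= in_take // Xs.
- by move=> e' e'X; apply: index_inj => //; apply: Xs.
- move=> e' e'X; apply: (sorted_leq_index (leT := fun e1 e2 => weight G e1 <= weight G e2)) => //.
  + by move=> ? ? ?; apply: le_trans.
  + exact: Xs.
- exists u, v; split=> // p up lp; rewrite -lte_fin; apply: lt_le_trans d _.
  apply: ereal_inf_lbound; exists p => //=; split=> //.
  apply: sub_path up => x y; rewrite /adj => /setDP[xyQ xyF]; rewrite in_setD xyF /=.
  move: xyQ; rewrite in_setU => /orP[|]; first exact/subsetP/greedy_run_sup.
  rewrite inE => /andP[xyX xye]; have [xyH xyQ] := setDP xyX.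
  (* An output edge of smaller index was present when [e] was tested, since the rest of the run adds
     only edges of the remaining list. *)
  move: xyH; rewrite -{1}(cat_take_drop (index e s) s) /run foldl_cat.
  move/(subsetP (greedy_run_sub _ _)); rewrite in_setU => /orP[//|].
  rewrite inE => xyd; exfalso; move: us; rewrite -(cat_take_drop (index e s) s) cat_uniq.
  case/and3P=> _ /hasPn/(_ _ xyd) + _.
  by rewrite /= in_take ?Xs // xye.
Qed.

End Greedy.

(** * The weight bound *)

Lemma is_cycleS (V : finType) (S T : {set {set V}}) c : S \subset T ->
  is_cycle S c -> is_cycle T c.
Proof.
move=> /subsetP ST /andP[c3 /andP[cS cu]]; rewrite /is_cycle c3 /ucycleb cu andbT /=.
by apply: sub_cycle cS => x y; apply: ST.
Qed.

(** A cut of at most [m] edges would be an admissible fault set: deleting it separates [u] from [v]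
    in [Q], while their edge, being outside [Q], survives in [G]. *)
Lemma eft_preserver_cut (R : realType) (V : finType) (G : wgraph R V) m
    (Q : {set {set V}}) u v (W : {set V}) : eft_preserver m G Q ->
  [set u; v] \in edges G :\: Q -> u \in W -> v \notin W -> (m < #|cut Q W|)%N.
Proof.
move=> [_ Qm] /setDP[uvG uvQ] uW vW; rewrite ltnNge; apply/negP=> /Qm Qcut.
have : connect (adj (Q :\: cut Q W)) u v.
  rewrite Qcut; apply: connect1; rewrite /adj in_setD uvG andbT.
  by apply: contra uvQ; rewrite inE => /andP[].
move/connect_cut=> /(_ W uW vW)[a [b [+ _ _]]].
by rewrite !inE => /andP[/andP[+ abQ] cr]; rewrite abQ cr.
Qed.

Section Bound.
Context {R : realType} {V : finType}.
Variables (G : wgraph R V) (k : R) (f : nat) (L : R).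
Variables (Q H : {set {set V}}) (rank : {set V} -> nat)
  (F : {set V} -> {set {set V}}).
Hypothesis k0 : 0 <= k.
Hypothesis preserverQ : eft_preserver (2 * f) G Q.
Hypothesis QH : Q \subset H.
Hypothesis HG : H \subset edges G.
Hypothesis lamL : (lambda #|V| (k + 1) <= L%:E)%E.
Let X := H :\: Q.
Hypothesis greedyX : forall e, e \in X -> [/\ (#|F e| <= f)%N,
    {in X, forall e', e' \in F e -> (rank e' < rank e)%N},
    {in X, forall e', rank e' = rank e -> e' = e},
    {in X, forall e', (rank e' <= rank e)%N -> weight G e' <= weight G e} &
    exists u v, e = [set u; v] /\ forall p,
      path (adj ((Q :|: [set e' in X | (rank e' < rank e)%N]) :\: F e)) u p ->
      last u p = v -> k * weight G e < walk_weight G u p].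

Let XG : X \subset edges G.
Proof. exact: fintype.subset_trans (subsetDl _ _) HG. Qed.

Let QG : Q \subset edges G.
Proof. exact: fintype.subset_trans QH HG. Qed.

(* In [M :|: D] the last edge [e] of [D] on a cycle is a heaviest one, by the
   exchange property of the minimum spanning forest [M] of [T :|: D]; the rest
   of the cycle was present and fault-free when [e] was tested. *)
Lemma fault_free_weight_le (T D : {set {set V}}) : T \subset Q -> D \subset X ->
  links T D -> {in D &, forall e e', e' \notin F e} ->
  {in D, forall e, [disjoint F e & T]} ->
  total_weight G D <= L * total_weight G T.
Proof.
move=> TQ DX lTD DF FT.
have TDG : T :|: D \subset edges G.
  by rewrite subUset (fintype.subset_trans TQ QG) (fintype.subset_trans DX XG).
have lT : links T (T :|: D).
  apply/linksP=> u v; rewrite inE => /orP[uvT|]; last exact: (linksP _ _ lTD).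
  exact: connect1.
have [M [MS lM Mac wM Mexch]] := minimum_spanning_forest TDG (subsetUl T D) lT.
have MDS : M :|: D \subset T :|: D by rewrite subUset MS subsetUr.
have MDG := fintype.subset_trans MDS TDG.
have L0 : 0 <= L.
  by rewrite -lee_fin; apply: le_trans lamL; apply: lambda_ge0.
apply: le_trans (total_weightS (subsetUr M D) MDG) _.
apply: le_trans (ler_wpM2l L0 wM).
apply: (@weight_le_lambda _ _ G _ _ (k + 1)) => //; first by rewrite addr_ge0.
- exact: subsetUl.
- by apply/linksP=> u v /(subsetP MDS)/(linksP _ _ lM).
move=> c cMD.
have cS := is_cycleS MDS cMD.
have cE := cycle_edges_sub cMD.
have [x xc] : exists x, x \in c.
  by case/andP: cMD; case: c {cS cE} => // x c _ _; exists x; rewrite mem_head.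
have g0c : [set x; next c x] \in cycle_edges c by apply/imsetP; exists x.
have [g gc gmax] := @arg_maxP _ _ _ _ (fun e => e \in cycle_edges c) (weight G) g0c.
have [d dP gd] : exists2 d, (d \in cycle_edges c) && (d \in D) & weight G g <= weight G d.
  have [gM|gM] := boolP (g \in M); last first.
    by exists g => //; move/(subsetP cE): (gc); rewrite inE (negPf gM) gc.
  have [d /setDP[dc dM] gd] := Mexch _ _ cS gc gM.
  by exists d => //; rewrite dc; move/(subsetP cE): dc; rewrite inE (negPf dM).
have [e /andP[ec eD] emax] := @arg_maxnP _ d
  (fun e => (e \in cycle_edges c) && (e \in D)) rank dP.
have eX := subsetP DX _ eD.
have [_ _ rank_inj rank_w [u [v [eE short]]]] := greedyX eX.
have e_heaviest e' : e' \in cycle_edges c -> weight G e' <= weight G e.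
  move=> e'c; apply: le_trans (gmax _ e'c) (le_trans gd _).
  by apply: rank_w; [case/andP: dP => _ /(subsetP DX)|apply: emax].
exists e; split=> //.
have [y [p [yE pu pc]]] := cycle_minus_edge cMD ec.
have pw : walk_weight G y p <= total_weight G (cycle_edges c :\ e).
  apply: walk_weight_le => //.
  by apply: fintype.subset_trans MDG; apply: fintype.subset_trans cE; apply: subD1set.
have pF : path (adj ((Q :|: [set e' in X | (rank e' < rank e)%N]) :\: F e)) y p.
  apply: sub_path pc => a b; rewrite /adj => /setD1P[abe abc].
  have /(subsetP cE)/(subsetP MDS) := abc; rewrite in_setU in_setD => /orP[abT|abD].
    by rewrite in_setU (subsetP TQ _ abT) (disjointFl (FT _ eD) abT).
  have abX := subsetP DX _ abD.
  have abr : (rank [set a; b] <= rank e)%N by apply: emax; rewrite abc.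
  rewrite DF //= in_setU; apply/orP; right; rewrite inE abX /= ltn_neqAle abr andbT.
  by apply: contraNneq abe => /rank_inj ->.
suff kw : k * weight G e < walk_weight G y p.
  by rewrite (total_weightD1 _ ec) mulrDl mul1r addrC ltrD2l (lt_le_trans kw).
have : (u = y /\ v = last y p) \/ (u = last y p /\ v = y).
  by apply: eq_set2; rewrite -eE.
case=> -[uE vE]; first by rewrite -uE; apply: short; rewrite ?uE.
have [p' [pp' lp' <-]] := rev_walk G pF.
by rewrite -uE; apply: short; rewrite uE ?vE.
Qed.

(** Apply the lambda bound to each edge of [Q] as a graph of its own. The product form, in place of
    [1 <= L], also covers weights that are all 0. *)
Lemma weight_preserver_le : total_weight G Q <= L * total_weight G Q.
Proof.
rewrite [X in _ * X]/total_weight mulr_sumr; apply: ler_sum => g gQ.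
have gG : [set g] \subset edges G by rewrite sub1set (subsetP QG).
have gac c : ~~ is_cycle [set g] c.
  apply/negP=> cg; have /andP[c3 _] := cg.
  have [x xc] : exists x, x \in c by case: c c3 {cg} => // x c; exists x; rewrite mem_head.
  have ec : [set x; next c x] \in cycle_edges c by apply/imsetP; exists x.
  have [y [p [eE _ pc]]] := cycle_minus_edge cg ec.
  have eg := subsetP (cycle_edges_sub cg) _ ec.
  case: p pc eE => [_|z p /andP[]] /= eE.
    have := edges_card2 (subsetP gG _ eg); rewrite eE.
    by rewrite setUid cards1.
  move: eE; rewrite /adj => /setD1P[+ /(subsetP (cycle_edges_sub cg))].
  by move: eg; rewrite !inE => /eqP-> /negPf->.
have := @weight_le_lambda _ _ G [set g] [set g] (k + 1) L.
rewrite /total_weight !big_set1; apply=> //; first by rewrite addr_ge0.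
  by apply/linksP=> u v; apply: connect1.
by move=> c cg; case/negP: (gac c).
Qed.

Lemma greedy_weight_le : (0 < f)%N ->
  total_weight G H <= 9 * f%:R * L * total_weight G Q.
Proof.
move=> f0.
have f1 : 1 <= f%:R :> R by rewrite ler1n.
have wQ0 := total_weight_ge0 QG; have wX0 := total_weight_ge0 XG.
have wQL := weight_preserver_le.
have L0 : 0 <= L by rewrite -lee_fin; apply: le_trans lamL; apply: lambda_ge0.
have wHE : total_weight G H = total_weight G Q + total_weight G X.
  by rewrite /total_weight (big_setID Q) /= (setIidPr QH).
(* Scaled so that the first part of [cost] sums over [Q] to at most a quarter of the weight of [X];
   if [Q] weighs 0, then [al] is 0. *)
pose al := total_weight G X / (4 * total_weight G Q).
have al0 : 0 <= al by rewrite divr_ge0 // mulr_ge0.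
have alQ : al * total_weight G Q <= total_weight G X / 4.
  have [->|wQn0] := eqVneq (total_weight G Q) 0; first by rewrite mulr0 divr_ge0.
  by rewrite /al invfM mulrA -mulrA mulVf // mulr1.
pose cost g := al * weight G g + \sum_(e in X) weight G e * (g \in F e)%:R.
have costE (S : {set {set V}}) : \sum_(g in S) cost g =
    al * total_weight G S + \sum_(e in X) weight G e * #|F e :&: S|%:R.
  rewrite big_split /= -mulr_sumr exchange_big /=; congr (_ + _).
  apply: eq_bigr => e _; rewrite -mulr_sumr -natr_sum; congr (_ * _%:R).
  rewrite -sum1_card [RHS](eq_bigl (fun g => (g \in S) && (g \in F e))).
    by rewrite [RHS]big_mkcondr; apply: eq_bigr => g _; case: (g \in F e).
  by move=> g; rewrite inE andbC.
have cost0 g : g \in Q -> 0 <= cost g.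
  move=> gQ; apply: addr_ge0.
    by apply: mulr_ge0 => //; apply/weight_ge0/(subsetP QG).
  by apply: sumr_ge0 => e eX; apply: mulr_ge0 => //; apply/weight_ge0/(subsetP XG).
(* Tolerance of [2 * f] faults gives every separating cut of [Q] at least [(2 * f).+1] edges. *)
have [T [TQ lT costT]] : exists T : {set {set V}}, [/\ T \subset Q, links T X &
    (2 * f).+1%:R * \sum_(g in T) cost g <= 2 * \sum_(g in Q) cost g].
  apply: steiner_forest_approx => // [e /(subsetP QG)/edges_card2 //|u v W uvX].
  apply: eft_preserver_cut preserverQ _; move: uvX.
  by rewrite !in_setD => /andP[-> /(subsetP HG) ->].
have wT0 : 0 <= total_weight G T.
  by apply: total_weight_ge0; apply: fintype.subset_trans TQ QG.
pose D0 := [set e in X | [disjoint F e & T]].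
have D0X : D0 \subset X by apply/subsetP=> e; rewrite inE => /andP[].
have [D [DD0 DF wD]] : exists D : {set {set V}}, [/\ D \subset D0,
    {in D &, forall e e', e' \notin F e} &
    \sum_(e in D0) weight G e <= f.+1%:R * \sum_(e in D) weight G e].
  apply: (heavy_independent_subset (rank := rank)).
  - move=> e e' /(subsetP D0X) eX /(subsetP D0X) e'X.
    by have [_ _ rank_inj _ _] := greedyX e'X; apply: rank_inj.
  - by move=> e /(subsetP D0X)/greedyX[].
  - move=> e e' /(subsetP D0X) eX /(subsetP D0X) e'X.
    by have [_ F_rank _ _ _] := greedyX eX; apply: F_rank.
have DX := fintype.subset_trans DD0 D0X.
have DT : total_weight G D <= L * total_weight G T.
  apply: fault_free_weight_le => //.
    by apply/linksP=> u v /(subsetP DX)/(linksP _ _ lT).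
  by move=> e /(subsetP DD0); rewrite inE => /andP[].
(* An edge of [X] outside [D0] has a fault set meeting [T], so it is counted at least once in the
   sum. *)
have wD0 : total_weight G X <= total_weight G D0 +
    \sum_(e in X) weight G e * #|F e :&: T|%:R.
  have -> : total_weight G D0 = \sum_(e in X) weight G e * [disjoint F e & T]%:R.
    rewrite /total_weight [LHS](eq_bigl (fun e => (e \in X) && [disjoint F e & T])).
      rewrite big_mkcondr; apply: eq_bigr => e _.
      by case: ifP; rewrite ?mulr1 ?mulr0.
    by move=> e; rewrite inE.
  rewrite -big_split /=; apply: ler_sum => e eX.
  rewrite -mulrDr ler_peMr ?weight_ge0 ?(subsetP XG) // -natrD ler1n.
  by rewrite -setI_eq0 -cards_eq0; case: #|_|.
have wFQ : \sum_(e in X) weight G e * #|F e :&: Q|%:R <= f%:R * total_weight G X.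
  rewrite mulr_sumr; apply: ler_sum => e eX; rewrite mulrC ler_wpM2r ?weight_ge0 ?(subsetP XG) //.
  rewrite ler_nat; have [Ff _ _ _ _] := greedyX eX.
  exact: leq_trans (subset_leq_card (subsetIl _ _)) Ff.
have wLQ0 : 0 <= L * total_weight G Q by rewrite mulr_ge0.
have [wX_0|wXn0] := eqVneq (total_weight G X) 0.
  by rewrite wHE wX_0 addr0 (le_trans wQL) // -mulrA ler_peMl //; lra.
have wX_gt0 : 0 < total_weight G X by rewrite lt_neqAle eq_sym wXn0.
(* The cost of [Q] is at most [f + 1/4] times the weight of [X]; doubled, this is [2 f + 1/2],
   strictly below [2 f + 1] since that weight is positive. *)
have alT_lt : al * total_weight G T < total_weight G D0.
  have : al * total_weight G T + \sum_(e in X) weight G e * #|F e :&: T|%:R <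
      total_weight G X; last by lra.
  have m0 : 0 < (2 * f).+1%:R :> R by rewrite ltr0n.
  rewrite -(ltr_pM2l m0) -costE; apply: le_lt_trans costT _.
  by rewrite costE -[(2 * f).+1%:R]natr1 natrM; lra.
have alT_lt' : al * total_weight G T < (f%:R + 1) * L * total_weight G T.
  rewrite natr1 -mulrA; apply: lt_le_trans alT_lt (le_trans wD _).
  by rewrite ler_wpM2l.
(* Strictness rules out weight 0 for [T], which may then be cancelled and also makes the weight of
   [Q] positive. *)
have wT_gt0 : 0 < total_weight G T.
  by rewrite lt_neqAle wT0 andbT; apply: contraTneq alT_lt' => <-; rewrite !mulr0 ltxx.
have wQ_gt0 := lt_le_trans wT_gt0 (total_weightS TQ QG).
have al_le : al <= (f%:R + 1) * L by rewrite ltW // -(ltr_pM2r wT_gt0).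
have wXE : total_weight G X = 4 * (al * total_weight G Q).
  by rewrite /al; field; rewrite gt_eqF.
have alQ_le : al * total_weight G Q <= (f%:R + 1) * (L * total_weight G Q).
  by rewrite mulrA ler_wpM2r.
have fLQ : L * total_weight G Q <= f%:R * (L * total_weight G Q) by rewrite ler_peMl.
(* The constant: [4 (f + 1) + 1 <= 9 f] as [f] is positive, the extra 1 paying for [Q] itself. *)
rewrite wHE wXE -[9 * _ * _]mulrA -mulrA -mulrA; move: alQ_le fLQ wQL wLQ0.
move: (al * _) (L * _) => x y; rewrite mulrDl mul1r; move: (f%:R * y) => z.
by lra.
Qed.

End Bound.

Theorem theorem3p8 (R : realType) :
  exists C : R, 0 < C /\
  forall (n : nat) (V : finType) (G : wgraph R V) (k : R) (f : nat)
         (H : {set {set V}}),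
    #|V| = n -> 1 <= k -> (0 < f)%N ->
    light_ft_greedy_output G k f H ->
    (competitive_lightness (2 * f) H G <=
       (C * f%:R)%:E * lambda n (k + 1))%E.
Proof.
exists 9; split=> // n V G k f H <- k1 f0 /light_ft_greedy_outputP.
case=> Q [rank [F [[preserverQ minQ] QH HG greedyX]]].
have k0 : 0 <= k := le_trans ler01 k1.
have -> : competitive_lightness (2 * f) H G =
    ((total_weight G H)%:E / (total_weight G Q)%:E)%E.
  congr (_ / _)%E; apply/le_anti/andP; split.
    by apply: ereal_inf_lbound; exists Q.
  by apply: le_ereal_inf_tmp => _ [Q' Q'P <-]; rewrite lee_fin minQ.
have Cf : (0 < (9 * f%:R)%:E :> \bar R)%E by rewrite lte_fin mulr_gt0 ?ltr0n.
(* If [lambda] is [+oo], so is the right-hand side, its other factor being positive. *)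
case lamE: (lambda #|V| (k + 1)) (lambda_ge0 #|V| (k + 1)) => [L| |] // _; last first.
  by rewrite gt0_muley // leey.
have lamL : (lambda #|V| (k + 1) <= L%:E)%E by rewrite lamE.
have := greedy_weight_le k0 preserverQ QH HG lamL greedyX f0.
have wQ0 : 0 <= total_weight G Q by apply/total_weight_ge0/(fintype.subset_trans QH).
have wH0 := total_weight_ge0 HG.
(* If [Q] weighs 0, the bound forces [H] to weigh 0 as well, and the ratio is 0 by convention. *)
rewrite inver; case: eqVneq => [->|wQn0] wHQ.
  have -> : total_weight G H = 0 by apply: le_anti; rewrite wH0 andbT -(mulr0 (9 * f%:R * L)).
  by rewrite mul0e -EFinM lee_fin mulr_ge0 ?mulr_ge0 // -lee_fin -lamE lambda_ge0.
by rewrite -!EFinM lee_fin ler_pdivrMr // lt_neqAle eq_sym wQn0.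
Qed.
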